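(* Let $\{z^t\}_{t\ge0}$ be a sequence generated by QRTC (as defined in the context), and let $z^*$ be an accumulation point of $\{z^t\}$. Let $K_1,K_2>0$ be constants such that for all $t\ge0$ $$f(z^t)-f(z^{t+1})\ge K_1\|z^t-z^{t+1}\|_2^2,\qquad K_2\|z^t-z^{t+1}\|_2\ge\|\Pi_\Lambda(\nabla f(z^t))\|_F,$$ and let $Z'$ be a neighborhood of $z^*$, $\theta\in[0,1)$ and $K_3>0$ be such that the Kurdyka–Łojasiewicz inequality $$|f(z)-f(z^* )|^\theta\le K_3\|\Pi_\Lambda(\nabla f(z))\|_F\qquad\text{for all } z\in Z'\cap\Lambda$$ holds. Assume $z^0\in B(z^*,\tau):=\{z:\|z-z^*\|_F<\tau\}\subset Z'$ with $$\tau>\frac{K_2K_3}{K_1(1-\theta)}|f(z^0)-f(z^* )|^{1-\theta}+\|z^0-z^*\|_2 .$$ Then $z^t\in B(z^*,\tau)$ for $t=0,1,2,\dots$. Moreover, $$\sum_{t=0}^\infty\|z^{t+1}-z^t\|_2\le\frac{K_2K_3}{K_1(1-\theta)}|f(z^0)-f(z^* )|^{1-\theta},\qquad \lim_{t\to\infty}z^t=z^*.$$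
   Context: $\mathbb{H}$ is the real quaternion algebra with units $\mathbf{i},\mathbf{j},\mathbf{k}$; for a quaternion matrix, $A^*$ is the conjugate transpose; $\|\cdot\|_F$ is the Frobenius norm of quaternion matrices/tensors (the Euclidean norm for real vectors); $\Re$ is the entrywise real part. Fix a unit pure quaternion $\mu$ ($\mu^2=-1$). $F_{\mu,n}\in\mathbb{H}^{n\times n}$ has entries $\frac1{\sqrt n}\left(\cos\frac{2\pi(p-1)(q-1)}{n}-\mu\sin\frac{2\pi(p-1)(q-1)}{n}\right)$. The QDFT $\hat{\mathcal{X}}$ of $\mathcal{X}\in\mathbb{H}^{n_1\times n_2\times n_3}$ is the tensor with $\hat{\mathcal{X}}(i,j,:)=\sqrt{n_3}\,F_{\mu,n_3}\mathcal{X}(i,j,:)$ (an invertible map), and $\hat{\mathcal{X}}^{(l)}=\hat{\mathcal{X}}(:,:,l)$. Data: $\mathcal{M}\in\mathbb{H}^{n_1\times n_2\times n_3}$ with $\Re(\mathcal{M})=0$; $\Omega\subseteq\{1,\dots,n_1\}\times\{1,\dots,n_2\}\times\{1,\dots,n_3\}$ with complement $\Omega^c$; $P_\Omega$ (resp. $P_{\Omega^c}$) keeps the entries indexed by $\Omega$ (resp. $\Omega^c$) and sets the others to zero; positive integers $\mathbf{r}=(r_1,\dots,r_{n_3})$; parameters $\lambda,\lambda_1,\lambda_2,\beta>0$. Variables: $\mathcal{C}=\mathcal{C}_{\mathbf i}\mathbf{i}+\mathcal{C}_{\mathbf j}\mathbf{j}+\mathcal{C}_{\mathbf k}\mathbf{k}$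 with real tensors $\mathcal{C}_\alpha\in\mathbb{R}^{n_1\times n_2\times n_3}$; $\hat{\mathcal{A}}=(\hat{\mathcal{A}}^{(l)})_{l=1}^{n_3}$ with $\hat{\mathcal{A}}^{(l)}\in\mathbb{H}^{n_1\times r_l}$; $\hat{\mathcal{B}}=(\hat{\mathcal{B}}^{(l)})_{l=1}^{n_3}$ with $\hat{\mathcal{B}}^{(l)}\in\mathbb{H}^{r_l\times n_2}$; $\|\hat{\mathcal{A}}\|_F^2=\sum_l\|\hat{\mathcal{A}}^{(l)}\|_F^2$, likewise for $\hat{\mathcal{B}}$. $\mathcal{A}*_\mu\mathcal{B}\in\mathbb{H}^{n_1\times n_2\times n_3}$ denotes the tensor whose QDFT has $l$-th frontal slice $\hat{\mathcal{A}}^{(l)}\hat{\mathcal{B}}^{(l)}$. All real components of $\mathcal{C},\hat{\mathcal{A}},\hat{\mathcal{B}}$ are collected in a real vector $z\in\mathbb{R}^{3n_1n_2n_3+4\|\mathbf{r}\|_1(n_1+n_2)}$. Let $\mathrm{TV}(\mathcal{C})=\lambda_1\sum_{k=1}^{n_1-1}\|\mathcal{C}(k,:,:)-\mathcal{C}(k+1,:,:)\|_F^2+\lambda_2\sum_{k=1}^{n_2-1}\|\mathcal{C}(:,k,:)-\mathcal{C}(:,k+1,:)\|_F^2$ and $$f(z)=\tfrac12\|\mathcal{A}*_\mu\mathcal{B}-\mathcal{C}\|_F^2+\tfrac{\lambda}{2n_3}\big(\|\hat{\mathcal{A}}\|_F^2+\|\hat{\mathcal{B}}\|_F^2\big)+\mathrm{TV}(\mathcal{C}).$$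 The feasible set is $\Lambda=\{z: P_\Omega(\mathcal{C}-\mathcal{M})=0\}$, and the problem is $\min_{z\in\Lambda}f(z)$. The projected gradient $\Pi_\Lambda(\nabla f(z))$ is the vector obtained from the real gradient $\nabla f(z)$ by replacing each block $\partial f/\partial\mathcal{C}_\alpha$ ($\alpha\in\{\mathbf i,\mathbf j,\mathbf k\}$) by $P_{\Omega^c}(\partial f/\partial\mathcal{C}_\alpha)$ and leaving the blocks for $\hat{\mathcal{A}},\hat{\mathcal{B}}$ unchanged. QRTC sequence: $z^0=(\mathcal{C}^0,\hat{\mathcal{A}}^0,\hat{\mathcal{B}}^0)\in\Lambda$ is arbitrary, and for $t=1,2,\dots$ (no stopping), $z^t=(\mathcal{C}^t,\hat{\mathcal{A}}^t,\hat{\mathcal{B}}^t)$ where: (1) $\mathcal{C}^t$ is the minimizer, over $\mathcal{C}$ with $\Re(\mathcal{C})=0$ and $P_\Omega(\mathcal{C}-\mathcal{M})=0$, of $\frac12\|\mathcal{A}^{t-1}*_\mu\mathcal{B}^{t-1}-\mathcal{C}\|_F^2+\mathrm{TV}(\mathcal{C})+\sum_{\alpha\in\{\mathbf i,\mathbf j,\mathbf k\}}\langle\delta^t_\alpha,\mathcal{C}_\alpha\rangle$, for some error tensor $\delta^t=\delta^t_{\mathbf i}\mathbf{i}+\delta^t_{\mathbf j}\mathbf{j}+\delta^t_{\mathbf k}\mathbf{k}$ (so $\Re(\delta^t)=0$) with $P_\Omega(\delta^t)=0$ and $\|P_{\Omega^c}(\delta^t)\|_F\le\frac14\|\mathcal{C}^t-\mathcal{C}^{t-1}\|_F$;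 (2) for each $l$, $\hat{\mathcal{A}}^{t,(l)}=\big(\hat{\mathcal{C}}^{t,(l)}(\hat{\mathcal{B}}^{t-1,(l)})^*+\beta\hat{\mathcal{A}}^{t-1,(l)}\big)\big(\hat{\mathcal{B}}^{t-1,(l)}(\hat{\mathcal{B}}^{t-1,(l)})^*+(\lambda+\beta)I\big)^{-1}$; (3) for each $l$, $\hat{\mathcal{B}}^{t,(l)}=\big((\hat{\mathcal{A}}^{t,(l)})^*\hat{\mathcal{A}}^{t,(l)}+(\lambda+\beta)I\big)^{-1}\big((\hat{\mathcal{A}}^{t,(l)})^*\hat{\mathcal{C}}^{t,(l)}+\beta\hat{\mathcal{B}}^{t-1,(l)}\big)$. *)

(* Defs.v *)
From HB Require Import structures.
From mathcomp Require Import all_boot all_order all_algebra.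
From mathcomp Require Import ring lra.
From mathcomp Require Import all_classical all_reals all_analysis.
Set Implicit Arguments.
Unset Strict Implicit.
Unset Printing Implicit Defensive.
Import Order.TTheory GRing.Theory Num.Theory.
Import numFieldNormedType.Exports.
Local Open Scope classical_set_scope.
Local Open Scope ring_scope.

(* [Quat a b c d] is a + b i + c j + d k. *)
Record quat (R : Type) := Quat { qre : R; qim_i : R; qim_j : R; qim_k : R }.

Definition quat_to_tuple (R : Type) (x : quat R) : R * R * R * R :=
  (qre x, qim_i x, qim_j x, qim_k x).
Definition quat_of_tuple (R : Type) (t : R * R * R * R) : quat R :=
  Quat t.1.1.1 t.1.1.2 t.1.2 t.2.
Lemma quat_to_tupleK (R : Type) : cancel (@quat_to_tuple R) (@quat_of_tuple R).
Proof. by case. Qed.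

HB.instance Definition _ (R : eqType) :=
  Equality.copy (quat R) (can_type (@quat_to_tupleK R)).
HB.instance Definition _ (R : choiceType) :=
  Choice.copy (quat R) (can_type (@quat_to_tupleK R)).

Section QuatRing.
Variable R : comNzRingType.
Implicit Types x y z : quat R.

Definition qadd x y := Quat (qre x + qre y) (qim_i x + qim_i y)
  (qim_j x + qim_j y) (qim_k x + qim_k y).
Definition qopp x := Quat (- qre x) (- qim_i x) (- qim_j x) (- qim_k x).
Definition qmul x y :=
  let: Quat a b c d := x in let: Quat a' b' c' d' := y in
  Quat (a * a' - b * b' - c * c' - d * d')
       (a * b' + b * a' + c * d' - d * c')
       (a * c' - b * d' + c * a' + d * b')
       (a * d' + b * c' - c * b' + d * a').

Fact qaddA : associative qadd.
Proof. by move=> [????] [????] [????]; rewrite /qadd /= !addrA. Qed.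
Fact qaddC : commutative qadd.
Proof. by move=> [????] [????]; congr Quat; exact: addrC. Qed.
Fact qadd0 : left_id (Quat 0 0 0 0) qadd.
Proof. by move=> [????]; rewrite /qadd /= !add0r. Qed.
Fact qaddN : left_inverse (Quat 0 0 0 0) qopp qadd.
Proof. by move=> [????]; rewrite /qadd /= !addNr. Qed.
HB.instance Definition _ := GRing.isZmodule.Build (quat R)
  qaddA qaddC qadd0 qaddN.

Fact qmulA : associative qmul.
Proof. by move=> [????] [????] [????]; congr Quat; ring. Qed.
Fact qmul1 : left_id (Quat 1 0 0 0) qmul.
Proof. by move=> [????]; congr Quat; ring. Qed.
Fact qmulr1 : right_id (Quat 1 0 0 0) qmul.
Proof. by move=> [????]; congr Quat; ring. Qed.
Fact qmulDl : left_distributive qmul +%R.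
Proof. by move=> [????] [????] [????]; congr Quat => /=; ring. Qed.
Fact qmulDr : right_distributive qmul +%R.
Proof. by move=> [????] [????] [????]; congr Quat => /=; ring. Qed.
Fact qone_neq0 : Quat 1 0 0 0 != 0 :> quat R.
Proof. by apply/eqP => -[] /eqP; rewrite oner_eq0. Qed.
HB.instance Definition _ := GRing.Zmodule_isNzRing.Build (quat R)
  qmulA qmul1 qmulr1 qmulDl qmulDr qone_neq0.

Definition qreal (a : R) : quat R := Quat a 0 0 0.
Definition qconj x := Quat (qre x) (- qim_i x) (- qim_j x) (- qim_k x).

End QuatRing.

Notation "a %:H" := (qreal a) (at level 2, format "a %:H")
  : ring_scope.

Section QuatTheory.
Variable R : realType.
Implicit Types (x y : quat R) (a b : R).

Definition qnorm x : R :=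
  Num.sqrt (qre x ^+ 2 + qim_i x ^+ 2 + qim_j x ^+ 2 + qim_k x ^+ 2).

Definition unit_pure x := qre x = 0 /\ qnorm x = 1.

Lemma unit_pure_sqr x : unit_pure x -> x ^+ 2 = -1.
Proof.
case: x => a b c d [/= -> /(congr1 (fun u => u ^+ 2))].
rewrite /qnorm sqr_sqrtr /= ?expr1n ?addr_ge0 ?sqr_ge0 // => h.
congr Quat => /=; [|ring|ring|ring].
by rewrite -h; ring.
Qed.

Lemma unit_pureN x : unit_pure x -> unit_pure (- x).
Proof.
case: x => a b c d [/= a0 h]; split; first by rewrite a0; exact: oppr0.
by rewrite -h /qnorm /= !sqrrN.
Qed.

Lemma qrealD a b : (a + b)%:H = a%:H + b%:H.
Proof. by congr Quat; rewrite /= ?addr0. Qed.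
Lemma qrealM a b : (a * b)%:H = a%:H * b%:H.
Proof. by congr Quat => /=; ring. Qed.
Lemma qrealC a x : a%:H * x = x * a%:H.
Proof. by case: x => *; congr Quat => /=; ring. Qed.
Lemma qreal0 : 0%:H = 0 :> quat R. Proof. by []. Qed.
Lemma qreal1 : 1%:H = 1 :> quat R. Proof. by []. Qed.
Lemma qrealN a : (- a)%:H = - a%:H.
Proof. by congr Quat; rewrite /= oppr0. Qed.
Lemma qreal_nat n : n%:R%:H = n%:R :> quat R.
Proof. by elim: n => // n ih; rewrite -!natr1 qrealD ih. Qed.

Lemma qconjM x : qconj x * x =
  (qre x ^+ 2 + qim_i x ^+ 2 + qim_j x ^+ 2 + qim_k x ^+ 2)%:H.
Proof. by case: x => *; congr Quat => /=; ring. Qed.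

Lemma qmul_eq0 x y : x * y = 0 -> x <> 0 -> y = 0.
Proof.
move=> xy x0; have := congr1 (fun u => qconj x * u) xy.
rewrite mulr0 mulrA qconjM; set s := (X in X%:H) => sy.
have s0 : s != 0.
  apply/eqP => s0; apply: x0; move: s0; rewrite /s => {sy s}; case: x {xy} => a b c d.
  move=> /= /eqP; rewrite !paddr_eq0 ?addr_ge0 ?sqr_ge0 // !sqrf_eq0.
  by case/andP => /andP[/andP[/eqP-> /eqP->] /eqP->] /eqP->.
have := congr1 (fun u => s^-1%:H * u) sy.
by rewrite mulr0 mulrA -qrealM mulVf // qreal1 mul1r.
Qed.

End QuatTheory.

Section QuatMatrix.
Variable R : realType.

Definition qadjmx m n (A : 'M[quat R]_(m, n)) : 'M[quat R]_(n, m) :=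
  map_mx (@qconj R) A^T.

Definition fnorm_mx m n (A : 'M[quat R]_(m, n)) : R :=
  Num.sqrt (\sum_i \sum_j qnorm (A i j) ^+ 2).

(* The library's [invmx] needs commutative entries; this is the two-sided
   inverse of a matrix that has one (it is unique), and 0 otherwise. *)
Definition qinvmx n (A : 'M[quat R]_n) : 'M[quat R]_n :=
  xget 0 [set W | A *m W = 1%:M /\ W *m A = 1%:M].

Lemma qinvmxE n (A W : 'M[quat R]_n) :
  A *m W = 1%:M -> W *m A = 1%:M -> qinvmx A = W.
Proof.
move=> AW WA; rewrite /qinvmx; case: xgetP => [V _ [AV _]|/(_ W)[]//].
by rewrite -[V]mul1mx -WA -mulmxA AV mulmx1.
Qed.

End QuatMatrix.

Notation tensor T n1 n2 n3 :=
  {ffun 'I_n1 * 'I_n2 * 'I_n3 -> T}.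

Section Tensor.
Variables (T : Type) (n1 n2 n3 : nat).
Implicit Type X : tensor T n1 n2 n3.

Definition tslice1 X (i : 'I_n1) : 'M[T]_(n2, n3) := \matrix_(j, l) X (i, j, l).
Definition tslice2 X (j : 'I_n2) : 'M[T]_(n1, n3) := \matrix_(i, l) X (i, j, l).
Definition tslice3 X (l : 'I_n3) : 'M[T]_(n1, n2) := \matrix_(i, j) X (i, j, l).
Definition ttube X (i : 'I_n1) (j : 'I_n2) : 'cV[T]_n3 := \col_l X (i, j, l).

End Tensor.

Definition tproj (V : zmodType) n1 n2 n3 (Om : {set 'I_n1 * 'I_n2 * 'I_n3})
    (X : tensor V n1 n2 n3) : tensor V n1 n2 n3 :=
  [ffun p => if p \in Om then X p else 0].

Section QuatTensor.
Variables (R : realType) (n1 n2 n3 : nat).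
Implicit Types X Y : tensor (quat R) n1 n2 n3.

Definition fnorm_t X : R := Num.sqrt (\sum_p qnorm (X p) ^+ 2).

Definition tpure X := forall p, qre (X p) = 0.

(* sum over the components i, j, k of the real inner products of X and Y *)
Definition tinner_im X Y : R :=
  (\sum_p qim_i (X p) * qim_i (Y p)) + (\sum_p qim_j (X p) * qim_j (Y p))
  + (\sum_p qim_k (X p) * qim_k (Y p)).

Definition TV (lam1 lam2 : R) X : R :=
  lam1 * (\sum_(k < n1) \sum_(k' < n1 | k' == k.+1 :> nat)
            fnorm_mx (tslice1 X k - tslice1 X k') ^+ 2)
  + lam2 * (\sum_(k < n2) \sum_(k' < n2 | k' == k.+1 :> nat)
            fnorm_mx (tslice2 X k - tslice2 X k') ^+ 2).

End QuatTensor.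

Section QDFT.
Variable R : realType.
Implicit Type mu : quat R.

(* Indices are 0-based here, so p and q stand for p-1 and q-1. *)
Definition qdft_mx mu n : 'M[quat R]_n := \matrix_(p, q)
  let x : R := 2 * pi * p%:R * q%:R / n%:R in
  (Num.sqrt n%:R)^-1%:H * ((cos x)%:H - mu * (sin x)%:H).

Definition qdft mu n1 n2 n3 (X : tensor (quat R) n1 n2 n3) :
    tensor (quat R) n1 n2 n3 :=
  [ffun p => ((Num.sqrt n3%:R)%:H *: (qdft_mx mu n3 *m ttube X p.1.1 p.1.2)) p.2 0].

(* The tensor A *_mu B, from the frontal slices of the transforms of the two
   factors; it exists and is unique, see [tprodP]. *)
Definition tprod mu n1 n2 n3 (r : 'I_n3 -> nat)
    (A : forall l, 'M[quat R]_(n1, r l)) (B : forall l, 'M[quat R]_(r l, n2)) :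
    tensor (quat R) n1 n2 n3 :=
  xget 0 [set X | forall l, tslice3 (qdft mu X) l = A l *m B l].

Let qexp mu (x : R) : quat R := (cos x)%:H + mu * (sin x)%:H.

Let qexpD mu : unit_pure mu ->
  forall x y, qexp mu (x + y) = qexp mu x * qexp mu y.
Proof.
case: mu => a b c d hmu x y.
have [/= a0 _] := hmu; subst a.
have h : b * b = 1 - c * c - d * d.
  have /(congr1 (@qre R)) /= := unit_pure_sqr hmu.
  by move=> h; rewrite -[1]opprK -h; ring.
by rewrite /qexp cosD sinD; congr Quat => /=; ring: h.
Qed.

Let qexp0 mu : qexp mu 0 = 1.
Proof. by rewrite /qexp cos0 sin0 mulr0 addr0. Qed.

Let qexpX mu : unit_pure mu -> forall x n, qexp mu (x *+ n) = qexp mu x ^+ n.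
Proof.
move=> hmu x; elim=> [|n ih]; first by rewrite mulr0n qexp0.
by rewrite mulrS qexpD // ih exprS.
Qed.

Let qexp2pi mu : qexp mu (2 * pi) = 1.
Proof.
by rewrite /qexp mulr_natl cos2pi sin2pi mulr0 addr0.
Qed.

Let qexpN mu x : qexp mu (- x) = qexp (- mu) x.
Proof. by rewrite /qexp cosN sinN qrealN mulrN mulNr. Qed.

Let qexp_neq1 mu (x : R) : unit_pure mu -> 0 < x < 2 * pi -> qexp mu x <> 1.
Proof.
case: mu => a b c d [/= -> _] /andP[x0 x2] /(congr1 (@qre R)) /=.
rewrite !mul0r !mulr0 !subr0 addr0 => cx.
have := @sin_gt0_pi R (x / 2).
rewrite divr_gt0 //= ltr_pdivrMr // [pi * 2]mulrC x2 => /(_ isT) s0.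
have := cos_mulr2n (x / 2); rewrite cos2sin2 -[x / 2 *+ 2]mulr_natr divfK ?pnatr_eq0 // cx.
by move: (exprn_gt0 2 s0) => {cx} s0' h; lra.
Qed.

Let qexp_sum0 mu n k : unit_pure mu -> (0 < k < n)%N ->
  \sum_(q < n) qexp mu ((2 * pi * k%:R / n%:R) *+ q) = 0.
Proof.
move=> hmu /andP[k0 kn]; have n0 : 0 < n%:R :> R by rewrite ltr0n (ltn_trans k0).
set x := 2 * pi * k%:R / n%:R.
under eq_bigr do rewrite qexpX //.
apply: (@qmul_eq0 _ (qexp mu x - 1)); last first.
  move/eqP; rewrite subr_eq0 => /eqP; apply: qexp_neq1 => //.
  rewrite divr_gt0 ?mulr_gt0 ?pi_gt0 ?ltr0n //= ?(ltn_trans k0) //.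
  by rewrite ltr_pdivrMr // ltr_pM2l ?mulr_gt0 ?pi_gt0 // ltr_nat.
rewrite -subrX1 -qexpX // -mulr_natr divfK ?gt_eqF // mulr_natr qexpX //.
by rewrite qexp2pi expr1n subrr.
Qed.

Let qdft_mxE mu n p q : qdft_mx mu n p q =
  (Num.sqrt n%:R)^-1%:H * qexp mu (- (2 * pi * p%:R * q%:R / n%:R)).
Proof. by rewrite mxE /qexp cosN sinN qrealN mulrN. Qed.

Lemma qdft_mxK mu n : unit_pure mu -> qdft_mx mu n *m qdft_mx (- mu) n = 1%:M.
Proof.
move=> hmu; apply/matrixP => p s; rewrite !mxE.
have n0 : (0 < n)%N by apply: leq_ltn_trans (ltn_ord p).
have nR0 : n%:R != 0 :> R by rewrite pnatr_eq0 -lt0n.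
pose x (k : nat) : R := 2 * pi * k%:R / n%:R.
have -> : \sum_q qdft_mx mu n p q * qdft_mx (- mu) n q s =
    n%:R^-1%:H * \sum_(q < n) qexp mu ((x s - x p) *+ q).
  rewrite mulr_sumr; apply: eq_bigr => q _.
  rewrite !qdft_mxE -[qexp (- mu) _]qexpN opprK mulrA -[_ * _ * _%:H]mulrA.
  rewrite -qrealC mulrA -qrealM -invfM -expr2 sqr_sqrtr ?ler0n // -mulrA -qexpD //.
  congr (_ * qexp _ _); rewrite /x -mulr_natr; field.
  by rewrite nR0.
have [->|ps] := eqVneq p s.
  rewrite subrr; under eq_bigr do rewrite mul0rn qexp0.
  rewrite sumr_const card_ord -qreal_nat -qrealM mulVf //.
have [sp|sp] := ltnP s p.
  have -> : x s - x p = - (x (p - s)%N).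
    by rewrite /x natrB 1?ltnW //; field; rewrite nR0.
  under eq_bigr do rewrite mulNrn qexpN.
  rewrite qexp_sum0 ?mulr0 //; first exact: unit_pureN.
  by rewrite subn_gt0 sp (leq_ltn_trans (leq_subr _ _)).
have -> : x s - x p = x (s - p)%N.
  by rewrite /x natrB //; field; rewrite nR0.
rewrite qexp_sum0 ?mulr0 // subn_gt0 ltn_neqAle sp andbT.
by rewrite -[(p : nat) == s]/(p == s) ps (leq_ltn_trans (leq_subr _ _)).
Qed.

Definition iqdft mu n1 n2 n3 (X : tensor (quat R) n1 n2 n3) :
    tensor (quat R) n1 n2 n3 :=
  [ffun p => ((Num.sqrt n3%:R)^-1%:H *:
              (qdft_mx (- mu) n3 *m ttube X p.1.1 p.1.2)) p.2 0].

Let ttube_qdft mu n1 n2 n3 (X : tensor (quat R) n1 n2 n3) i j :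
  ttube (qdft mu X) i j = (Num.sqrt n3%:R)%:H *: (qdft_mx mu n3 *m ttube X i j).
Proof. by apply/matrixP => l k; rewrite [k]ord1 mxE ffunE. Qed.

Let ttube_iqdft mu n1 n2 n3 (X : tensor (quat R) n1 n2 n3) i j :
  ttube (iqdft mu X) i j =
  (Num.sqrt n3%:R)^-1%:H *: (qdft_mx (- mu) n3 *m ttube X i j).
Proof. by apply/matrixP => l k; rewrite [k]ord1 mxE ffunE. Qed.

Let mulmx_qrealr m n p (a : R) (A : 'M[quat R]_(m, n)) (B : 'M[quat R]_(n, p)) :
  A *m (a%:H *: B) = a%:H *: (A *m B).
Proof.
apply/matrixP => i j; rewrite !mxE mulr_sumr; apply: eq_bigr => k _.
by rewrite !mxE !mulrA qrealC.
Qed.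

Let sqrtn_neq0 n (l : 'I_n) : Num.sqrt n%:R != 0 :> R.
Proof. by rewrite sqrtr_eq0 -ltNge ltr0n (leq_ltn_trans _ (ltn_ord l)). Qed.

Let tensorP n1 n2 n3 (X Y : tensor (quat R) n1 n2 n3) :
  (forall i j, ttube X i j = ttube Y i j) -> X = Y.
Proof.
move=> XY; apply/ffunP => -[[i j] l].
by have /matrixP/(_ l 0) := XY i j; rewrite !mxE.
Qed.

Lemma qdftK mu n1 n2 n3 : unit_pure mu ->
  cancel (@qdft mu n1 n2 n3) (@iqdft mu n1 n2 n3).
Proof.
move=> hmu X; apply/ffunP => -[[i j] l]; rewrite ffunE /= ttube_qdft.
rewrite mulmx_qrealr mulmxA -{2}[mu]opprK qdft_mxK; last exact: unit_pureN.
by rewrite mul1mx scalerA -qrealM mulVf ?(sqrtn_neq0 l) // scale1r mxE.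
Qed.

Lemma iqdftK mu n1 n2 n3 : unit_pure mu ->
  cancel (@iqdft mu n1 n2 n3) (@qdft mu n1 n2 n3).
Proof.
move=> hmu X; apply/ffunP => -[[i j] l]; rewrite ffunE /= ttube_iqdft.
rewrite mulmx_qrealr mulmxA qdft_mxK //.
by rewrite mul1mx scalerA -qrealM mulfV ?(sqrtn_neq0 l) // scale1r mxE.
Qed.

Lemma tprodP mu n1 n2 n3 (r : 'I_n3 -> nat)
    (A : forall l, 'M[quat R]_(n1, r l)) (B : forall l, 'M[quat R]_(r l, n2))
    (X : tensor (quat R) n1 n2 n3) : unit_pure mu ->
  (forall l, tslice3 (qdft mu X) l = A l *m B l) <-> X = tprod mu A B.
Proof.
move=> hmu; pose Y : tensor (quat R) n1 n2 n3 :=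
  [ffun p => (A p.2 *m B p.2) p.1.1 p.1.2].
have YE l : tslice3 Y l = A l *m B l by apply/matrixP => i j; rewrite mxE ffunE.
have ex : [set X | forall l, tslice3 (qdft mu X) l = A l *m B l] (iqdft mu Y).
  by move=> l; rewrite iqdftK.
have h := xgetPex 0 (ex_intro _ _ ex); rewrite -/(tprod mu A B) /= in h.
split=> [hX|-> //]; apply: (can_inj (qdftK hmu)); apply/ffunP => -[[i j] l].
by have /matrixP/(_ i j) := etrans (hX l) (esym (h l)); rewrite !mxE.
Qed.

Lemma tprodE mu n1 n2 n3 (r : 'I_n3 -> nat)
    (A : forall l, 'M[quat R]_(n1, r l)) (B : forall l, 'M[quat R]_(r l, n2)) :
  unit_pure mu ->
  tprod mu A B = iqdft mu [ffun p => (A p.2 *m B p.2) p.1.1 p.1.2].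
Proof.
move=> hmu; apply/esym/tprodP => // l; rewrite iqdftK //.
by apply/matrixP => i j; rewrite mxE ffunE.
Qed.

End QDFT.

Section Variables.
Variables (n1 n2 n3 : nat) (r : 'I_n3 -> nat).

(* [CIdx (a, p)] is the component a (0, 1, 2 for i, j, k) of the entry p of C;
   [AIdx] (resp. [BIdx]) takes an entry of the l-th slice of A (resp. B) and one
   of its four components (0, 1, 2, 3 for 1, i, j, k). *)
Definition zidx : finType :=
  ('I_3 * ('I_n1 * 'I_n2 * 'I_n3)
   + ({l : 'I_n3 & 'I_n1 * 'I_(r l)}%type * 'I_4
      + {l : 'I_n3 & 'I_(r l) * 'I_n2}%type * 'I_4))%type.

Definition CIdx (u : 'I_3 * ('I_n1 * 'I_n2 * 'I_n3)) : zidx := inl u.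
Definition AIdx (l : 'I_n3) (i : 'I_n1) (k : 'I_(r l)) (c : 'I_4) : zidx :=
  inr (inl (Tagged (fun l => ('I_n1 * 'I_(r l))%type) (i, k), c)).
Definition BIdx (l : 'I_n3) (k : 'I_(r l)) (j : 'I_n2) (c : 'I_4) : zidx :=
  inr (inr (Tagged (fun l => ('I_(r l) * 'I_n2)%type) (k, j), c)).

Definition zdim : nat :=
  (3 * (n1 * n2 * n3) + 4 * (\sum_l r l) * (n1 + n2))%N.

Lemma card_zidx : #|zidx| = zdim.
Proof.
rewrite /zidx !card_sum !card_prod !card_tagged !card_ord !sumnE !big_map.
rewrite -!enumT !big_enum /= /zdim; congr (_ + _)%N.
under eq_bigr do rewrite card_prod !card_ord.
under [in X in (_ + X)%N]eq_bigr do rewrite card_prod !card_ord.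
by rewrite -big_distrr -big_distrl /= mulnDr; ring.
Qed.

Definition zpos (x : zidx) : 'I_zdim := cast_ord card_zidx (enum_rank x).
Definition zlab (i : 'I_zdim) : zidx := enum_val (cast_ord (esym card_zidx) i).

Lemma zposK : cancel zpos zlab.
Proof. by move=> x; rewrite /zlab /zpos cast_ordK enum_rankK. Qed.
Lemma zlabK : cancel zlab zpos.
Proof. by move=> i; rewrite /zlab /zpos enum_valK cast_ordKV. Qed.

End Variables.

Definition l2norm (R : realType) N (v : 'rV[R]_N) : R :=
  Num.sqrt (\sum_i v 0 i ^+ 2).

Definition grad (R : realType) N (g : 'rV[R]_N -> R) (x : 'rV[R]_N) : 'rV[R]_N :=
  \row_i 'D_(delta_mx 0 i) g x.

Section Problem.
Variables (R : realType) (n1 n2 n3 : nat) (r : 'I_n3 -> nat).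
Local Notation zvec := 'rV[R]_(zdim n1 n2 r).
Implicit Type z : zvec.

Definition Ccomp z (a : 'I_3) : tensor R n1 n2 n3 :=
  [ffun p => z 0 (zpos (CIdx r (a, p)))].

Definition Cof z : tensor (quat R) n1 n2 n3 :=
  [ffun p => Quat 0 (Ccomp z (inord 0) p) (Ccomp z (inord 1) p)
                    (Ccomp z (inord 2) p)].

Definition Aof z (l : 'I_n3) : 'M[quat R]_(n1, r l) :=
  \matrix_(i, k) let x c := z 0 (zpos (AIdx n2 i k (inord c))) in
                 Quat (x 0%N) (x 1%N) (x 2%N) (x 3%N).

Definition Bof z (l : 'I_n3) : 'M[quat R]_(r l, n2) :=
  \matrix_(k, j) let x c := z 0 (zpos (BIdx n1 k j (inord c))) in
                 Quat (x 0%N) (x 1%N) (x 2%N) (x 3%N).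

Definition objective (mu : quat R) (lam lam1 lam2 : R) z : R :=
  1 / 2 * fnorm_t (tprod mu (Aof z) (Bof z) - Cof z) ^+ 2
  + lam / (2 * n3%:R) *
      (\sum_l fnorm_mx (Aof z l) ^+ 2 + \sum_l fnorm_mx (Bof z l) ^+ 2)
  + TV lam1 lam2 (Cof z).

Variables (M : tensor (quat R) n1 n2 n3) (Om : {set 'I_n1 * 'I_n2 * 'I_n3}).

Definition feasible : set zvec := [set z | tproj Om (Cof z - M) = 0].

(* Applied to the gradient of the objective, this is the projected gradient. *)
Definition zproj z : zvec :=
  \row_i match zlab i with
         | inl (a, p) => tproj (~: Om) (Ccomp z a) p
         | inr _ => z 0 i
         end.

Section QRTC.
Variables (mu : quat R) (lam lam1 lam2 beta : R).

Definition C_subobjective z0 (delta C : tensor (quat R) n1 n2 n3) : R :=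
  1 / 2 * fnorm_t (tprod mu (Aof z0) (Bof z0) - C) ^+ 2 + TV lam1 lam2 C
  + tinner_im delta C.

Definition C_update z0 z1 : Prop :=
  exists delta : tensor (quat R) n1 n2 n3,
  [/\ tpure delta, tproj Om delta = 0,
      fnorm_t (tproj (~: Om) delta) <= 1 / 4 * fnorm_t (Cof z1 - Cof z0),
      tpure (Cof z1) /\ tproj Om (Cof z1 - M) = 0
    & forall C, tpure C -> tproj Om (C - M) = 0 ->
        C_subobjective z0 delta (Cof z1) <= C_subobjective z0 delta C].

Definition A_update z0 z1 : Prop := forall l,
  Aof z1 l =
    (tslice3 (qdft mu (Cof z1)) l *m qadjmx (Bof z0 l) + beta%:H *: Aof z0 l)
    *m qinvmx (Bof z0 l *m qadjmx (Bof z0 l) + (lam + beta)%:H%:M).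

Definition B_update z0 z1 : Prop := forall l,
  Bof z1 l =
    qinvmx (qadjmx (Aof z1 l) *m Aof z1 l + (lam + beta)%:H%:M)
    *m (qadjmx (Aof z1 l) *m tslice3 (qdft mu (Cof z1)) l
        + beta%:H *: Bof z0 l).

Definition QRTC_sequence (z : nat -> zvec) : Prop :=
  feasible (z 0%N) /\
  forall t, [/\ C_update (z t) (z t.+1), A_update (z t) (z t.+1)
              & B_update (z t) (z t.+1)].

End QRTC.
End Problem.

(* |x|^a with the convention 0^0 = 0 usual in the Kurdyka-Lojasiewicz
   inequality; the library's power has 0 `^ 0 = 1, with which the inequality at
   a critical point could never hold with exponent 0. *)
Definition KLpow (R : realType) (x a : R) : R :=
  if x == 0 then 0 else `|x| `^ a.

(* Main.v *)
Require Import Defs.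
From HB Require Import structures.
From mathcomp Require Import all_boot all_order all_algebra.
From mathcomp Require Import ring lra.
From mathcomp Require Import all_classical all_reals all_analysis.
Set Implicit Arguments.
Unset Strict Implicit.
Unset Printing Implicit Defensive.
Import Order.TTheory GRing.Theory Num.Theory.
Import numFieldNormedType.Exports.
Local Open Scope classical_set_scope.
Local Open Scope ring_scope.

(** The finite-length argument of Kurdyka and Lojasiewicz. Let [f] be the objective and
    [e t] the gap [f (z t) - f zs]. It decreases by the descent condition, and it is
    nonnegative because [zs] is an accumulation point and the objective is
    continuous. While [z t] is in the ball, the Kurdyka-Lojasiewicz inequality
    and the relative error bound give [e t `^ theta <= K2 * K3 * d], where [d] is
    the length of the step from [z t] to [z t.+1], whereas
    [K1 * d ^+ 2 <= e t - e t.+1]. Concavity of [x `^ (1 - theta)] turns this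
    quadratic gain into a linear one ([KL_step]):

      [d <= c * (e t `^ (1 - theta) - e t.+1 `^ (1 - theta))],
      [c = K2 * K3 / (K1 * (1 - theta))].

    The right-hand side telescopes, so the path travelled so far is at most
    [c * e 0 `^ (1 - theta)]. The choice of [tau] makes this too short to leave
    the ball, so the induction goes on, and the bound on the whole length is the
    limit of the same sums. The telescoping also works from any later time [n]:
    all later iterates are within
    [l2norm (z n - zs) + c * e n `^ (1 - theta)] of [zs], and this is arbitrarily
    small for suitable [n], again by continuity at the accumulation point.

    The iterates are feasible by construction, so the Kurdyka-Lojasiewicz
    inequality applies to them. Continuity of the objective is clear once the
    tensor product is written explicitly as an inverse transform: every entry is
    then a quaternion polynomial in the variables ([continuous_objective]). *)

(** * Continuity of real-valued functions *)

Section RealContinuity.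
Variables (R : realType) (T : topologicalType).
Implicit Types u v : T -> R.

Lemma continuous_add u v : continuous u -> continuous v ->
  continuous (fun w => u w + v w).
Proof. by move=> uc vc w; exact: (cvgD (uc w) (vc w)). Qed.

Lemma continuous_sub u v : continuous u -> continuous v ->
  continuous (fun w => u w - v w).
Proof. by move=> uc vc w; exact: (cvgB (uc w) (vc w)). Qed.

Lemma continuous_mul u v : continuous u -> continuous v ->
  continuous (fun w => u w * v w).
Proof. by move=> uc vc w; exact: (cvgM (uc w) (vc w)). Qed.

Lemma continuous_sqr u :
  continuous u -> continuous (fun w => u w ^+ 2).
Proof. by move=> uc w; exact: (cvgM (uc w) (uc w)). Qed.

Lemma continuous_sqrt u :
  continuous u -> continuous (fun w => Num.sqrt (u w)).
Proof.
move=> uc w; apply: (@continuous_comp _ _ _ u (@Num.sqrt R)); first exact: uc.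
exact: sqrt_continuous.
Qed.

Lemma continuous_bigsum (I : Type) (s : seq I) (P : pred I) (F : I -> T -> R) :
  (forall i, continuous (F i)) ->
  continuous (fun w => \sum_(i <- s | P i) F i w).
Proof.
move=> Fc; elim: s => [|i s ih].
  rewrite (_ : (fun _ => _) = cst 0); first exact: cst_continuous.
  by apply/funext => x; rewrite big_nil.
rewrite (_ : (fun _ => _) = fun x =>
    (if P i then F i x else 0) + \sum_(j <- s | P j) F j x); last first.
  by apply/funext => x; rewrite big_cons; case: (P i); rewrite ?add0r.
by apply: continuous_add; case: (P i) => //; exact: cst_continuous.
Qed.

End RealContinuity.

(** * The Euclidean norm of a row vector *)

Section L2norm.
Variables (R : realType) (N : nat).
Implicit Types u v : 'rV[R]_N.

Lemma l2norm_ge0 u : 0 <= l2norm u.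
Proof. exact: sqrtr_ge0. Qed.

Lemma l2norm_sqr u : l2norm u ^+ 2 = \sum_i u 0 i ^+ 2.
Proof. by rewrite sqr_sqrtr // sumr_ge0 // => i _; exact: sqr_ge0. Qed.

Lemma l2norm0 : l2norm (0 : 'rV[R]_N) = 0.
Proof.
by rewrite /l2norm big1 ?sqrtr0 // => i _; rewrite mxE expr0n.
Qed.

Lemma l2normN u : l2norm (- u) = l2norm u.
Proof.
by congr Num.sqrt; apply: eq_bigr => i _; rewrite mxE sqrrN.
Qed.

Lemma l2norm_distC u v : l2norm (u - v) = l2norm (v - u).
Proof. by rewrite -opprB l2normN. Qed.

Lemma coord_le_l2norm u i : `|u 0 i| <= l2norm u.
Proof.
rewrite -(@ler_pXn2r _ 2) ?nnegrE ?l2norm_ge0 // real_normK ?num_real //.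
rewrite l2norm_sqr (bigD1 i) //= lerDl sumr_ge0 // => j _.
exact: sqr_ge0.
Qed.

(** The topology of row vectors is that of the sup norm, so convergence in the
    Euclidean norm has to be transferred through this bound. *)
Lemma norm_le_l2norm u : `|u| <= l2norm u.
Proof.
rewrite /Num.norm/= mx_normE -[leRHS]/((NngNum (l2norm_ge0 u))%:num) num_le.
apply/bigmax_leP; split=> [|[i j] _]; rewrite -num_le //= ?l2norm_ge0 //.
by rewrite ord1; exact: coord_le_l2norm.
Qed.

(** Cauchy-Schwarz, from the nonnegativity of
    [l2norm (l2norm v *: u - l2norm u *: v) ^+ 2]. *)
Lemma dot_le_l2norm u v : \sum_i u 0 i * v 0 i <= l2norm u * l2norm v.
Proof.
have [u0|u0] := eqVneq (l2norm u) 0.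
  rewrite u0 mul0r big1 // => i _; have := coord_le_l2norm u i.
  by rewrite u0 normr_le0 => /eqP->; rewrite mul0r.
have [v0|v0] := eqVneq (l2norm v) 0.
  rewrite v0 mulr0 big1 // => i _; have := coord_le_l2norm v i.
  by rewrite v0 normr_le0 => /eqP->; rewrite mulr0.
have a0 : 0 < l2norm u by rewrite lt_def u0 l2norm_ge0.
have b0 : 0 < l2norm v by rewrite lt_def v0 l2norm_ge0.
have : 0 <= \sum_i (l2norm v * u 0 i - l2norm u * v 0 i) ^+ 2.
  by apply: sumr_ge0 => i _; exact: sqr_ge0.
have -> : \sum_i (l2norm v * u 0 i - l2norm u * v 0 i) ^+ 2 =
    2 * (l2norm u * l2norm v) *
      (l2norm u * l2norm v - \sum_i u 0 i * v 0 i).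
  under eq_bigr do rewrite sqrrB !exprMn.
  rewrite big_split sumrB /= -!mulr_sumr -!l2norm_sqr.
  rewrite (eq_bigr (fun i => 2 * (l2norm u * l2norm v) * (u 0 i * v 0 i))).
    by rewrite -mulr_sumr; ring.
  by move=> i _; ring.
by rewrite pmulr_rge0 ?subr_ge0 // !mulr_gt0.
Qed.

Lemma ler_l2normD u v : l2norm (u + v) <= l2norm u + l2norm v.
Proof.
rewrite -(@ler_pXn2r _ 2) ?nnegrE ?addr_ge0 ?l2norm_ge0 // l2norm_sqr.
under eq_bigr do rewrite mxE sqrrD.
rewrite !big_split /= -!l2norm_sqr sqrrD lerD2r lerD2l mulr2n.
by rewrite lerD // dot_le_l2norm.
Qed.

Lemma continuous_l2norm_dist v :
  continuous (fun u : 'rV[R]_N => l2norm (u - v)).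
Proof.
apply: continuous_sqrt; apply: continuous_bigsum => i; apply: continuous_sqr.
under eq_fun do rewrite !mxE.
by apply: continuous_sub; [exact: coord_continuous|exact: cst_continuous].
Qed.

End L2norm.

(** * Concavity of real powers *)

(** With [y] the right-hand side, take logarithms: the point [1] is the
    barycentre of [x / y] and [y^-1] with weights [s] and [1 - s], so the bound
    [ln t <= t - 1] at these two points adds up to
    [s * ln x - ln y <= 0]. *)
Lemma powR_bernoulli (R : realType) (x s : R) :
  0 < x -> 0 < s <= 1 -> x `^ s <= 1 + s * (x - 1).
Proof.
move=> x0 /andP[s0 s1].
have y0 : 0 < 1 + s * (x - 1).
  have -> : 1 + s * (x - 1) = (1 - s) + s * x by ring.
  by rewrite ltr_wpDl ?mulr_gt0 // subr_ge0.
set y := 1 + s * (x - 1) in y0 *.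
rewrite -ler_ln ?posrE ?powR_gt0 // ln_powR.
have hx : ln x - ln y <= x / y - 1.
  rewrite -ln_div ?posrE //.
  have -> : x / y = 1 + (x / y - 1) by ring.
  by rewrite addrAC subrr add0r le_ln1Dx // ltrBDl addrN divr_gt0.
have h1 : - ln y <= y^-1 - 1.
  rewrite -lnV ?posrE //.
  have -> : y^-1 = 1 + (y^-1 - 1) by ring.
  by rewrite addrAC subrr add0r le_ln1Dx // ltrBDl addrN invr_gt0.
have : s * (ln x - ln y) + (1 - s) * (- ln y) <= 0.
  have -> : 0 = s * (x / y - 1) + (1 - s) * (y^-1 - 1).
    by rewrite /y; field; rewrite -/y gt_eqF.
  by rewrite lerD // ler_wpM2l // ?subr_ge0 // ltW.
have -> : s * (ln x - ln y) + (1 - s) * (- ln y) = s * ln x - ln y by ring.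
by rewrite subr_le0.
Qed.

(** The graph of the concave function [x `^ (1 - theta)] lies below its tangent at
    [a], whose slope is [(1 - theta) / a `^ theta]; the slope is multiplied out so
    that the bound can be combined with an upper bound on [a `^ theta]. *)
Lemma powR_tangent (R : realType) (a b theta : R) :
  0 < a -> 0 <= b -> 0 <= theta < 1 ->
  (1 - theta) * (a - b) <= a `^ theta * (a `^ (1 - theta) - b `^ (1 - theta)).
Proof.
move=> a0 b0 /andP[t0 t1].
have s0 : 0 < 1 - theta by rewrite subr_gt0.
have aa : a `^ theta * a `^ (1 - theta) = a.
  by rewrite -powRD ?(gt_eqF a0) ?implybT // subrKC powRr1 // ltW.
have [->|bn0] := eqVneq b 0.
  rewrite powR0 ?gt_eqF // !subr0 aa ler_piMl ?(ltW a0) //.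
  by rewrite gerBl.
have {bn0}bp : 0 < b by rewrite lt_def bn0.
have x0 : 0 < b / a by rewrite divr_gt0.
have s01 : 0 < 1 - theta <= 1 by rewrite s0 gerBl.
have := powR_bernoulli x0 s01; rewrite -(ler_pM2l a0).
have -> : a * (b / a) `^ (1 - theta) = a `^ theta * b `^ (1 - theta).
  by rewrite -{1}aa -mulrA -powRM ?ltW // mulrCA mulfV ?mulr1 // gt_eqF.
have -> : a * (1 + (1 - theta) * (b / a - 1)) = a + (1 - theta) * (b - a).
  by field; rewrite gt_eqF.
by rewrite (mulrBr (a `^ theta)) aa; lra.
Qed.

(** * Descent sequences under the Kurdyka-Lojasiewicz inequality *)

Section KLDescent.
Variables (R : realType) (N : nat) (f g : 'rV[R]_N -> R) (S : set 'rV[R]_N).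
Variables (z : nat -> 'rV[R]_N) (zs : 'rV[R]_N) (K1 K2 K3 theta tau : R).
Hypothesis f_cont : {for zs, continuous f}.
Hypothesis z_cluster : cluster (z @ \oo) zs.
Hypothesis zS : forall t, S (z t).
Hypotheses (K1_gt0 : 0 < K1) (K2_gt0 : 0 < K2) (K3_gt0 : 0 < K3).
Hypothesis theta01 : 0 <= theta < 1.
Hypothesis descent : forall t,
  K1 * l2norm (z t - z t.+1) ^+ 2 <= f (z t) - f (z t.+1).
Hypothesis g_step : forall t, g (z t) <= K2 * l2norm (z t - z t.+1).
Hypothesis KL : forall w, l2norm (w - zs) < tau -> S w ->
  KLpow (f w - f zs) theta <= K3 * g w.

Let e t := f (z t) - f zs.
Let step t := l2norm (z t.+1 - z t).
Let c := K2 * K3 / (K1 * (1 - theta)).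

Let s_gt0 : 0 < 1 - theta.
Proof. by case/andP: theta01 => _; rewrite subr_gt0. Qed.

Let c_gt0 : 0 < c.
Proof. by rewrite divr_gt0 ?mulr_gt0. Qed.

Lemma KL_value_nonincreasing m n : (m <= n)%N -> e n <= e m.
Proof.
elim: n => [|n ih]; first by rewrite leqn0 => /eqP->.
rewrite leq_eqVlt => /predU1P[-> //|]; rewrite ltnS => /ih; apply: le_trans.
rewrite lerD2r -subr_ge0; apply: le_trans (descent n).
by rewrite mulr_ge0 ?sqr_ge0 // ltW.
Qed.

(** If [f (z t) < f zs], then by continuity [f] exceeds [f (z t)] near [zs], hence
    at some iterate after [t], against monotonicity. *)
Lemma KL_value_ge0 t : 0 <= e t.
Proof.
rewrite leNgt; apply/negP => et0.
have nA : nbhs zs [set w | f (z t) < f w].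
  have nf : nbhs (f zs) [set y | f (z t) < y] by apply: lt_nbhsr; rewrite -subr_lt0.
  exact: f_cont nf.
have oA : (z @ \oo) (z @` [set n | (t <= n)%N]).
  by exists t => // n /= tn; exists n.
have [_ [[n /= tn <-] /= ltf]] := z_cluster oA nA.
by have := KL_value_nonincreasing tn; rewrite lerD2r leNgt ltf.
Qed.

(** If the gap vanishes then so does the step, by descent. Otherwise multiply the
    tangent bound [powR_tangent] by the Kurdyka-Lojasiewicz bound
    [e t `^ theta <= K3 * (K2 * D)] and cancel one factor [D]. *)
Lemma KL_step t : l2norm (z t - zs) < tau ->
  step t <= c * e t `^ (1 - theta) - c * e t.+1 `^ (1 - theta).
Proof.
move=> zt; rewrite /step l2norm_distC.
have desc : K1 * l2norm (z t - z t.+1) ^+ 2 <= e t - e t.+1.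
  by apply: le_trans (descent t) _; rewrite /e; lra.
set D := l2norm _ in desc *; have D0 : 0 <= D by exact: l2norm_ge0.
have [et0|etn0] := eqVneq (e t) 0.
  have et1 : e t.+1 = 0.
    by apply/le_anti; rewrite KL_value_ge0 andbT -et0 KL_value_nonincreasing.
  rewrite et0 et1 subrr.
  have D2 : D ^+ 2 <= 0 by move: desc; rewrite et0 et1 subr0 pmulr_rle0.
  have /eqP : D ^+ 2 = 0 by apply/le_anti; rewrite D2 sqr_ge0.
  by rewrite sqrf_eq0 => /eqP->.
have et_gt0 : 0 < e t by rewrite lt_def etn0 KL_value_ge0.
have kl : e t `^ theta <= K3 * (K2 * D).
  have := KL zt (zS t); rewrite /KLpow -/(e t) (negbTE etn0) gtr0_norm //.
  by move=> /le_trans; apply; rewrite ler_pM2l.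
(* A zero step would make the positive number e t `^ theta vanish. *)
have [D_eq0|Dn0] := eqVneq D 0.
  by have := powR_gt0 theta et_gt0; rewrite ltNge (le_trans kl) // D_eq0 !mulr0.
have Dp : 0 < D by rewrite lt_def Dn0.
set p := e t `^ (1 - theta); set q := e t.+1 `^ (1 - theta).
have pq : q <= p.
  by rewrite ge0_ler_powR ?nnegrE ?KL_value_ge0 ?KL_value_nonincreasing // ltW.
have h1 := powR_tangent et_gt0 (KL_value_ge0 t.+1) theta01.
have h2 : (1 - theta) * (K1 * D ^+ 2) <= K3 * (K2 * D) * (p - q).
  apply: le_trans (le_trans _ h1) _; first by rewrite ler_pM2l.
  by rewrite ler_wpM2r // subr_ge0.
rewrite -mulrBr /c mulrAC ler_pdivlMr ?mulr_gt0 // -(ler_pM2l Dp).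
by apply: le_trans (le_trans _ h2) _; rewrite le_eqVlt; apply/orP; left;
   apply/eqP; ring.
Qed.

(** The steps after time [n] have total length at most [c * e n `^ (1 - theta)].
    Only the times before [m] have to be in the ball, which is what lets
    [KL_in_ball] go by strong induction. *)
Lemma KL_dist m : (forall t, (t < m)%N -> l2norm (z t - zs) < tau) ->
  forall n, (n <= m)%N ->
  l2norm (z m - zs) <= l2norm (z n - zs) + c * e n `^ (1 - theta).
Proof.
move=> zb n nm.
suff : l2norm (z m - zs) <= l2norm (z n - zs) + c * e n `^ (1 - theta)
         - c * e m `^ (1 - theta).
  by move/le_trans; apply; rewrite gerBl mulr_ge0 ?powR_ge0 // ltW.
elim: m nm zb => [|m ih].
  by rewrite leqn0 => /eqP-> _; rewrite addrK.
rewrite leq_eqVlt => /predU1P[<- _|]; first by rewrite addrK.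
rewrite ltnS => nm zb; have zm := zb m (ltnSn m).
have := ih nm (fun t tm => zb t (ltnW tm)).
have := KL_step zm; rewrite /step => h1 h2.
rewrite -(subrKA (z m)); apply: le_trans (ler_l2normD _ _) _; lra.
Qed.

Hypothesis tau_gt : c * `|e 0| `^ (1 - theta) + l2norm (z 0%N - zs) < tau.

Lemma KL_in_ball t : l2norm (z t - zs) < tau.
Proof.
elim/ltn_ind: t => t ih; apply: le_lt_trans (KL_dist ih (leq0n t)) _.
by rewrite addrC -[X in X `^ _]ger0_norm ?KL_value_ge0.
Qed.

Lemma KL_length :
  (\sum_(0 <= t <oo) (step t)%:E <= (c * `|e 0| `^ (1 - theta))%:E)%E.
Proof.
apply: lime_le; first by apply: is_cvg_nneseries => t _ _; rewrite lee_fin l2norm_ge0.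
apply: nearW => n; rewrite sumEFin lee_fin ger0_norm ?KL_value_ge0 //.
apply: (@le_trans _ _ (c * e 0%N `^ (1 - theta) - c * e n `^ (1 - theta))).
  elim: n => [|n ih]; first by rewrite big_nil subrr.
  by rewrite big_nat_recr //=; have := KL_step (KL_in_ball n); lra.
by rewrite gerBl mulr_ge0 ?powR_ge0 // ltW.
Qed.

Lemma KL_cvg : z t @[t --> \oo] --> zs.
Proof.
apply/cvgrPdist_lt => eps eps0.
(* The gap d for which c * d `^ (1 - theta) is eps / 2. *)
pose d := (eps / 2 / c) `^ (1 - theta)^-1.
have q0 : 0 < eps / 2 / c by apply: divr_gt0 c_gt0; exact: divr_gt0.
have d0 : 0 < d by exact: powR_gt0.
have nA : nbhs zs [set w | f w < f zs + d].
  have nf : nbhs (f zs) [set y | y < f zs + d] by apply: lt_nbhsl; rewrite ltrDl.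
  exact: f_cont nf.
have nB : nbhs zs [set w | l2norm (w - zs) < eps / 2].
  have nl : nbhs (l2norm (zs - zs)) [set y | y < eps / 2].
    by apply: lt_nbhsl; rewrite subrr l2norm0 divr_gt0.
  exact: (@continuous_l2norm_dist R N zs zs _ nl).
have oA : (z @ \oo) (range z) by exists 0%N => // n _; exists n.
have [_ [[n _ <-] [/= fn zn]]] := z_cluster oA (filterI nA nB).
exists n => // t /= nt; rewrite distrC.
apply: le_lt_trans (norm_le_l2norm _) _.
apply: le_lt_trans (KL_dist (fun i _ => KL_in_ball i) nt) _.
suff : c * e n `^ (1 - theta) <= eps / 2 by move: zn => /=; lra.
rewrite mulrC -ler_pdivlMr //.
have -> : eps / 2 / c = d `^ (1 - theta).
  by rewrite -powRrM mulVf ?gt_eqF // powRr1 // ltW.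
rewrite ge0_ler_powR ?nnegrE ?KL_value_ge0 ?(ltW d0) //; first exact: ltW.
by rewrite lerBlDl ltW.
Qed.

End KLDescent.

(** Here [g] stands for the norm of the projected gradient: it passes the lower
    bound of the Kurdyka-Lojasiewicz inequality on to the length of the step. *)
Theorem KL_descent_convergence (R : realType) (N : nat)
    (f g : 'rV[R]_N -> R) (S : set 'rV[R]_N) (z : nat -> 'rV[R]_N)
    (zs : 'rV[R]_N) (K1 K2 K3 theta tau : R) :
  {for zs, continuous f} -> cluster (z @ \oo) zs -> (forall t, S (z t)) ->
  0 < K1 -> 0 < K2 -> 0 < K3 -> 0 <= theta < 1 ->
  (forall t, K1 * l2norm (z t - z t.+1) ^+ 2 <= f (z t) - f (z t.+1)) ->
  (forall t, g (z t) <= K2 * l2norm (z t - z t.+1)) ->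
  (forall w, l2norm (w - zs) < tau -> S w ->
    KLpow (f w - f zs) theta <= K3 * g w) ->
  K2 * K3 / (K1 * (1 - theta)) * `|f (z 0%N) - f zs| `^ (1 - theta)
    + l2norm (z 0%N - zs) < tau ->
  [/\ forall t, l2norm (z t - zs) < tau,
      (\sum_(0 <= t <oo) (l2norm (z t.+1 - z t))%:E
        <= (K2 * K3 / (K1 * (1 - theta))
            * `|f (z 0%N) - f zs| `^ (1 - theta))%:E)%E
    & z t @[t --> \oo] --> zs].
Proof.
move=> fc zc zS K1p K2p K3p th desc gs KL tau_gt; split.
- exact: (KL_in_ball fc zc zS K1p K2p K3p th desc gs KL tau_gt).
- exact: (KL_length fc zc zS K1p K2p K3p th desc gs KL tau_gt).
- exact: (KL_cvg fc zc zS K1p K2p K3p th desc gs KL tau_gt).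
Qed.

(** * Continuity of the objective *)

Section QuatContinuity.
Variables (R : realType) (T : topologicalType).
Implicit Types g h : T -> quat R.

(** Continuity for the product topology of four copies of [R]. *)
Definition qcontinuous g :=
  [/\ continuous (fun w => qre (g w)), continuous (fun w => qim_i (g w)),
      continuous (fun w => qim_j (g w)) & continuous (fun w => qim_k (g w))].

Lemma qcontinuous_cst (c : quat R) : qcontinuous (fun=> c).
Proof. by split=> w; exact: cvg_cst. Qed.

Lemma qcontinuousD g h :
  qcontinuous g -> qcontinuous h -> qcontinuous (fun w => g w + h w).
Proof.
move=> [ga gb gc gd] [ha hb hc hd].
split; [exact: (continuous_add ga ha)|exact: (continuous_add gb hb)
       |exact: (continuous_add gc hc)|exact: (continuous_add gd hd)].
Qed.

Lemma qcontinuousM g h :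
  qcontinuous g -> qcontinuous h -> qcontinuous (fun w => g w * h w).
Proof.
move=> [ga gb gc gd] [ha hb hc hd].
rewrite (_ : (fun w => _) = fun w =>
    Quat (qre (g w)) (qim_i (g w)) (qim_j (g w)) (qim_k (g w))
    * Quat (qre (h w)) (qim_i (h w)) (qim_j (h w)) (qim_k (h w))); last first.
  by apply/funext => w; case: (g w) => ????; case: (h w).
split.
- by apply: (continuous_sub (continuous_sub (continuous_sub _ _) _) _);
     exact: continuous_mul.
- by apply: (continuous_sub (continuous_add (continuous_add _ _) _) _);
     exact: continuous_mul.
- by apply: (continuous_add (continuous_add (continuous_sub _ _) _) _);
     exact: continuous_mul.
- by apply: (continuous_add (continuous_sub (continuous_add _ _) _) _);
     exact: continuous_mul.
Qed.

Lemma qcontinuousB g h :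
  qcontinuous g -> qcontinuous h -> qcontinuous (fun w => g w - h w).
Proof.
move=> gc hc; under eq_fun do rewrite -mulN1r; apply: qcontinuousD gc _.
exact: qcontinuousM (qcontinuous_cst _) hc.
Qed.

Lemma qcontinuous_bigsum (I : Type) (s : seq I) (P : pred I) (F : I -> T -> quat R) :
  (forall i, qcontinuous (F i)) ->
  qcontinuous (fun w => \sum_(i <- s | P i) F i w).
Proof.
move=> Fc; elim: s => [|i s ih].
  rewrite (_ : (fun _ => _) = cst 0); first exact: qcontinuous_cst.
  by apply/funext => x; rewrite big_nil.
rewrite (_ : (fun _ => _) = fun x =>
    (if P i then F i x else 0) + \sum_(j <- s | P j) F j x); last first.
  by apply/funext => x; rewrite big_cons; case: (P i); rewrite ?add0r.
by apply: qcontinuousD ih; case: (P i) => //; exact: qcontinuous_cst.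
Qed.

Lemma continuous_qnorm g : qcontinuous g -> continuous (fun w => qnorm (g w)).
Proof.
case=> ga gb gc gd; apply: continuous_sqrt.
by apply: (continuous_add (continuous_add (continuous_add _ _) _) _);
   exact: continuous_sqr.
Qed.

Lemma continuous_fnorm_mx m n (A : T -> 'M[quat R]_(m, n)) :
  (forall i j, qcontinuous (fun w => A w i j)) ->
  continuous (fun w => fnorm_mx (A w)).
Proof.
move=> Ac; apply: continuous_sqrt; do 2!apply: continuous_bigsum => ?.
exact/continuous_sqr/continuous_qnorm.
Qed.

Lemma continuous_fnorm_t n1 n2 n3 (X : T -> tensor (quat R) n1 n2 n3) :
  (forall p, qcontinuous (fun w => X w p)) ->
  continuous (fun w => fnorm_t (X w)).
Proof.
move=> Xc; apply: continuous_sqrt; apply: continuous_bigsum => p.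
exact/continuous_sqr/continuous_qnorm.
Qed.

Lemma continuous_TV lam1 lam2 n1 n2 n3 (X : T -> tensor (quat R) n1 n2 n3) :
  (forall p, qcontinuous (fun w => X w p)) ->
  continuous (fun w => TV lam1 lam2 (X w)).
Proof.
move=> Xc w; apply: cvgD; (apply: cvgM; first exact: cvg_cst);
  move: w; do 2!apply: continuous_bigsum => ?; apply/continuous_sqr;
  apply: continuous_fnorm_mx => i j; under eq_fun do rewrite !mxE;
  exact: qcontinuousB.
Qed.

(** [tprodE] replaces the choice that defines [tprod] by the inverse transform, of
    which each entry is a fixed linear combination of the slice products. *)
Lemma qcontinuous_tprod (mu : quat R) n1 n2 n3 (r : 'I_n3 -> nat)
    (A : T -> forall l, 'M[quat R]_(n1, r l))
    (B : T -> forall l, 'M[quat R]_(r l, n2)) (p : 'I_n1 * 'I_n2 * 'I_n3) :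
  unit_pure mu ->
  (forall l i k, qcontinuous (fun w => A w l i k)) ->
  (forall l k j, qcontinuous (fun w => B w l k j)) ->
  qcontinuous (fun w => tprod mu (A w) (B w) p).
Proof.
move=> hmu Ac Bc; under eq_fun do rewrite tprodE // ffunE !mxE.
apply: qcontinuousM; first exact: qcontinuous_cst.
apply: qcontinuous_bigsum => l; apply: qcontinuousM.
  exact: qcontinuous_cst.
under eq_fun do rewrite mxE ffunE mxE.
by apply: qcontinuous_bigsum => k; apply: qcontinuousM.
Qed.

End QuatContinuity.

Lemma continuous_objective (R : realType) n1 n2 n3 (r : 'I_n3 -> nat)
    (mu : quat R) (lam lam1 lam2 : R) : unit_pure mu ->
  continuous (@objective R n1 n2 n3 r mu lam lam1 lam2).
Proof.
move=> hmu.
have Cc p : qcontinuous (fun w : 'rV[R]_(zdim n1 n2 r) => Cof w p).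
  under eq_fun do rewrite ffunE !ffunE.
  by split=> w; [exact: cst_continuous|exact: coord_continuous..].
have Ac l i k : qcontinuous (fun w : 'rV[R]_(zdim n1 n2 r) => Aof w l i k).
  by under eq_fun do rewrite mxE; split=> w; exact: coord_continuous.
have Bc l k j : qcontinuous (fun w : 'rV[R]_(zdim n1 n2 r) => Bof w l k j).
  by under eq_fun do rewrite mxE; split=> w; exact: coord_continuous.
have mulc (a : R) (h : 'rV[R]_(zdim n1 n2 r) -> R) :
    continuous h -> continuous (fun w => a * h w).
  by apply: continuous_mul; exact: cst_continuous.
apply: continuous_add; last exact: continuous_TV.
apply: continuous_add; apply: mulc.
  apply: continuous_sqr; apply: continuous_fnorm_t => p.
  under eq_fun do rewrite ffunE [X in _ + X]ffunE.
  by apply: qcontinuousB => //; exact: qcontinuous_tprod.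
by apply: continuous_add; apply: continuous_bigsum => l;
   apply/continuous_sqr/continuous_fnorm_mx.
Qed.

(** * Convergence of the iterates *)

Theorem theorem4p4 (R : realType) (n1 n2 n3 : nat)
    (hn1 : (0 < n1)%N) (hn2 : (0 < n2)%N) (hn3 : (0 < n3)%N)
    (mu : quat R) (hmu : unit_pure mu)
    (M : tensor (quat R) n1 n2 n3) (hM : tpure M)
    (Om : {set 'I_n1 * 'I_n2 * 'I_n3})
    (r : 'I_n3 -> nat) (hr : forall l, (0 < r l)%N)
    (lam lam1 lam2 beta : R)
    (hlam : 0 < lam) (hlam1 : 0 < lam1) (hlam2 : 0 < lam2) (hbeta : 0 < beta)
    (z : nat -> 'rV[R]_(zdim n1 n2 r))
    (hz : QRTC_sequence M Om mu lam lam1 lam2 beta z)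
    (zs : 'rV[R]_(zdim n1 n2 r)) (hzs : cluster (z @ \oo) zs)
    (K1 K2 : R) (hK1 : 0 < K1) (hK2 : 0 < K2)
    (hdescent : forall t,
      objective mu lam lam1 lam2 (z t) - objective mu lam lam1 lam2 (z t.+1)
        >= K1 * l2norm (z t - z t.+1) ^+ 2)
    (hgrad : forall t,
      K2 * l2norm (z t - z t.+1)
        >= l2norm (zproj Om (grad (@objective R n1 n2 n3 r mu lam lam1 lam2) (z t))))
    (Z' : set 'rV[R]_(zdim n1 n2 r)) (hZ' : nbhs zs Z')
    (theta K3 : R) (htheta : 0 <= theta < 1) (hK3 : 0 < K3)
    (hKL : forall w, (Z' `&` feasible M Om) w ->
      KLpow (objective mu lam lam1 lam2 w - objective mu lam lam1 lam2 zs) theta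
        <= K3 * l2norm (zproj Om (grad (@objective R n1 n2 n3 r mu lam lam1 lam2) w)))
    (tau : R)
    (hz0 : l2norm (z 0%N - zs) < tau)
    (hball : [set w | l2norm (w - zs) < tau] `<=` Z')
    (htau : tau > K2 * K3 / (K1 * (1 - theta))
        * `|objective mu lam lam1 lam2 (z 0%N) - objective mu lam lam1 lam2 zs|
            `^ (1 - theta)
        + l2norm (z 0%N - zs)) :
  [/\ forall t, l2norm (z t - zs) < tau,
      (\sum_(0 <= t <oo) (l2norm (z t.+1 - z t))%:E
        <= (K2 * K3 / (K1 * (1 - theta))
            * `|objective mu lam lam1 lam2 (z 0%N)
                - objective mu lam lam1 lam2 zs| `^ (1 - theta))%:E)%E
    & z t @[t --> \oo] --> zs].
Proof.
have zS t : feasible M Om (z t).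
  by case: hz; case: t => // t _ /(_ t)[[delta [_ _ _ [_ ? _]] _ _]].
apply: (KL_descent_convergence _ hzs zS hK1 hK2 hK3 htheta hdescent hgrad _ htau).
  exact: continuous_objective.
by move=> w wb wS; apply: hKL; split => //; exact: hball.
Qed.
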